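(* Assume that the estimators $\widehat\theta_1,\dots,\widehat\theta_{J_n}$ approximate the sample $\theta_1,\dots,\theta_{J_n}$ in the sense defined in the context (measurability and the deviation bound), that $\Theta$ is compact, and that there are positive finite constants $\alpha$ and $B$ such that $J_n\le Bn^\alpha$ and $J_n\to+\infty$. Let $\widehat\mu_{J_n}=\frac1{J_n}\sum_{j=1}^{J_n}\delta_{\widehat\theta_j}$. Then $\widehat\mu_{J_n}\rightharpoonup\mu$ almost surely as $J_n\to\infty$, meaning that for every continuously differentiable compactly supported function $g$, $$\widehat\mu_{J_n}g=\frac1{J_n}\sum_{j=1}^{J_n}g(\widehat\theta_j)\longrightarrow\mu g=\mathbf E(g(\theta))\quad\text{almost surely.}$$
   Context: Model: $\theta_1,\theta_2,\dots$ are i.i.d. random variables with distribution $\mu$, whose support is $\Theta\subset\mathbb R$; $\theta$ denotes a generic variable with law $\mu$. For each $n$, with $J_n$ the number of curves ($J_n\ge 1$ an integer depending on $n$, with $n\to\infty$), one observes $$Y_{ij}=f^{[j]}(t_i-\theta_j)+\sigma\varepsilon_{ij},\qquad t_i=i/n,\ i=1,\dots,n,\ j=1,\dots,J_n,$$ where $f^{[j]}$ are unknown functions, $\sigma>0$ is known, and the $\varepsilon_{ij}$ are i.i.d. standard normal, independent of the $\theta_j$'s. Approximation property: the random variables $\widehat\theta_j=\widehat\theta_{j,n}$, $1\le j\le J_n$, approximate $\theta_1,\dots,\theta_{J_n}$ if each $\widehat\theta_j$ is measurable with respect to the observations $Y_{1j},\dots,Y_{nj}$ of the $j$-th curve and the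 following deviation bound holds: there exist positive constants $c_1,c_2$ such that for any $K>0$, for $n$ large enough, uniformly in $j\in\{1,\dots,J_n\}$ and in $\theta_j\in\Theta$ (and over the class of functions to which the $f^{[j]}$ belong), with $x_n=K\sqrt{\log n}$, $$\mathbf P\left(\sqrt n\,|\widehat\theta_j-\theta_j|>x_n\,\middle|\,\theta_j\right)\le c_1\exp(-c_2x_n^2).$$ $\delta_x$ denotes the Dirac mass at $x$. *)

(* Defs.v *)
From HB Require Import structures.
From mathcomp Require Import all_boot all_order all_algebra.
From mathcomp Require Import all_classical all_reals all_analysis.

Set Implicit Arguments.
Unset Strict Implicit.
Unset Printing Implicit Defensive.

Import Order.TTheory GRing.Theory Num.Theory.
Import numFieldNormedType.Exports.

Local Open Scope classical_set_scope.
Local Open Scope ring_scope.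

Section independence.
Context d (Omega : measurableType d) (R : realType) (P : probability Omega R).

Definition mutually_independent (I : eqType) (X : I -> {RV P >-> R}) : Prop :=
  forall (s : seq I) (B : I -> set R), uniq s ->
    (forall i, measurable (B i)) ->
    P (\big[setI/setT]_(i <- s) (X i @^-1` B i)) =
    (\prod_(i <- s) P (X i @^-1` B i))%E.

Definition sigma_family (I : Type) (X : I -> {RV P >-> R}) :
    set (set Omega) :=
  <<s \bigcup_i preimage_set_system setT (X i) measurable >>.

Definition independent_families (I I' : Type)
    (X : I -> {RV P >-> R}) (X' : I' -> {RV P >-> R}) : Prop :=
  forall A A', sigma_family X A -> sigma_family X' A' ->
    P (A `&` A') = (P A * P A')%E.

Definition has_law (X : {RV P >-> R}) (nu : set R -> \bar R) : Prop :=
  forall A, measurable A -> distribution P X A = nu A.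

(* q is a version of x |-> P(E | X = x). *)
Definition cond_prob_given (E : set Omega) (X : {RV P >-> R}) (q : R -> R) :
    Prop :=
  measurable_fun setT q /\
  forall B, measurable B ->
    P (E `&` X @^-1` B) = (\int[distribution P X]_(x in B) (q x)%:E)%E.

End independence.

Definition measure_support (R : realType) (mu : set R -> \bar R) : set R :=
  [set x | forall U, open U -> U x -> (0 < mu U)%E].

Section model.
Context d (Omega : measurableType d) (R : realType) (P : probability Omega R).
(* Indices start at 0: theta j is the shift of curve j.+1, and eps n i j is the
   noise of that curve at the design point i.+1 / n when n points are observed.
   Nothing is said on the joint law of eps n and eps n' for n <> n'; a noise
   array that does not depend on n is a particular case. *)
Variables (theta : nat -> {RV P >-> R})
  (eps : nat -> nat -> nat -> {RV P >-> R}) (sigma : R).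

Definition noise (J : nat -> nat) (n : nat) (ij : 'I_n * 'I_(J n)) :
    {RV P >-> R} := eps n ij.1 ij.2.

Definition shifted_curves_model (mu : probability R R) (J : nat -> nat) :
    Prop :=
  [/\ mutually_independent theta,
      forall j, has_law (theta j) mu,
      forall n, mutually_independent (@noise J n),
      forall n ij, has_law (@noise J n ij) (normal_prob 0 1) &
      forall n, independent_families (@noise J n) theta].

Definition observation (f : R -> R) (n j i : nat) (w : Omega) : R :=
  f (i.+1%:R / n%:R - theta j w) + sigma * eps n i j w.

Definition curve_data (f : R -> R) (n j : nat) (w : Omega) : n.-tuple R :=
  [tuple observation f n j i w | i < n].

(* An estimator maps the data of the j-th curve to a guess of theta j; as a
   function of the data only, it makes sense for every regression function f. *)
Variable est : forall n : nat, nat -> n.-tuple R -> R.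

Definition theta_hat (f : R -> R) (n j : nat) (w : Omega) : R :=
  est j (curve_data f n j w).

Definition approximates (Theta : set R) (F : set (R -> R)) (J : nat -> nat) :
    Prop :=
  (forall n j f, (j < J n)%N -> F f ->
    preimage_set_system setT (theta_hat f n j) measurable `<=`
    g_sigma_preimage (fun i : 'I_n => observation f n j i)) /\
  exists c1 c2 : R, [/\ 0 < c1, 0 < c2 &
    forall K : R, 0 < K -> \forall n \near \oo,
      let x_n := K * Num.sqrt (ln n%:R) in
      forall j f, (j < J n)%N -> F f ->
      exists q : R -> R,
        cond_prob_given
          [set w | Num.sqrt n%:R * `|theta_hat f n j w - theta j w| > x_n]
          (theta j) q /\
        forall x, Theta x -> q x <= c1 * expR (- c2 * x_n ^+ 2)].

(* The junk value at J n = 0 is the zero measure. *)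
Definition empirical_measure (f : nat -> R -> R) (J : nat -> nat) (n : nat)
    (w : Omega) : {measure set R -> \bar R} :=
  mscale ((J n)%:R^-1)%:nng
    (msum (fun j => \d_(theta_hat (f j) n j w)) (J n)).

End model.

Definition C1_compact_support (R : realType) (g : R -> R) : Prop :=
  [/\ forall x, derivable g x 1, continuous (derive1 g) &
      compact (closure [set x | g x != 0])].

(* Main.v *)
Require Import Defs.
From HB Require Import structures.
From mathcomp Require Import all_boot all_order all_algebra.
From mathcomp Require Import all_classical all_reals all_analysis.
From mathcomp Require Import measurable_realfun ring lra.

Set Implicit Arguments.
Unset Strict Implicit.
Unset Printing Implicit Defensive.

Import Order.TTheory GRing.Theory Num.Theory.
Import numFieldNormedType.Exports.

Local Open Scope classical_set_scope.
Local Open Scope ring_scope.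

(** Since g is Lipschitz, with some constant L, the error splits as

        | mean of g (theta_hat_j) - mu g |
          <= L * max_(j < J_n) |theta_hat_j - theta_j|
             + | mean of g (theta_j) - mu g |.

    First term.  Integrating the conditional deviation bound over the law of
    theta_j removes the conditioning; the bound is only assumed on the support
    of mu, but the complement of the support is negligible
    ([measure_support_negligible]).  With K such that c2 K^2 = alpha + 2 each
    deviation probability is at most c1 n^-(alpha + 2), and a union bound over
    the J_n <= B n^alpha curves leaves B c1 / n^2, which is summable.  By
    Borel-Cantelli, almost surely all the errors |theta_hat_j - theta_j|,
    j < J_n, are eventually at most K sqrt (ln n / n), which tends to 0
    ([ae_uniform_deviation]).

    Second term.  J_n may tend to infinity arbitrarily slowly, so bounds that
    are summable in J_n need not be summable in n: convergence along J_n is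
    obtained from the strong law of large numbers for the whole sequence
    g (theta_j) ([ae_mean_cvg_of_independent]).  As g is bounded, second moments
    suffice: Chebyshev's inequality gives summable bounds for the partial sums
    of length k^4, and boundedness controls the sums of intermediate length
    ([slln_bounded_uncorrelated]).  Independence makes the
    covariances vanish, by Fubini's theorem. *)

(** * Borel-Cantelli with a quadratic rate *)

Lemma sum_inv_sqr_le (R : realType) (n : nat) :
  \sum_(0 <= k < n) (k.+1%:R ^- 2) <= 2 :> R.
Proof.
(* The sharper bound telescopes: 1/(n+2)^2 <= 1/(n+1) - 1/(n+2). *)
suff : \sum_(0 <= k < n.+1) (k.+1%:R ^- 2) <= 2 - n.+1%:R^-1 :> R.
  move=> h; have : \sum_(0 <= k < n) (k.+1%:R ^- 2) <= 2 - n.+1%:R^-1 :> R.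
    apply: le_trans h; rewrite big_nat_recr//= lerDl.
    by rewrite invr_ge0 exprn_ge0.
  by move/le_trans; apply; rewrite gerBl.
elim: n => [|n IH]; first by rewrite big_nat1 !mulr1n expr1n !invr1; lra.
rewrite big_nat_recr//= (le_trans (lerD IH (lexx _)))//.
have n0 : (0 : R) <= n%:R by [].
rewrite -[n.+2]addn1 -[n.+1]addn1 !natrD.
set x : R := n%:R in n0 *.
rewrite -subr_ge0.
have -> : 2 - (x + 1 + 1)^-1 - (2 - (x + 1)^-1 + (x + 1 + 1) ^- 2) =
   (x + 1)^-1 * (x + 1 + 1) ^- 2 :> R.
  by field; apply/andP; split; lra.
by rewrite mulr_ge0// invr_ge0 ?exprn_ge0; lra.
Qed.

Section borel_cantelli.
Context d (T : measurableType d) (R : realType) (P : probability T R).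

Lemma borel_cantelli_inv_sqr (C : R) (F : nat -> set T) :
  (forall n, measurable (F n)) ->
  (forall n, P (F n) <= (C / n.+1%:R ^+ 2)%:E)%E ->
  {ae P, forall w, \forall n \near \oo, ~ F n w}.
Proof.
move=> mF PF.
have C0 : 0 <= C.
  have := le_trans (measure_ge0 P _) (PF 0%N).
  by rewrite lee_fin expr1n divr1.
exists (lim_sup_set F); split.
- by apply: bigcapT_measurable => n; exact: bigcup_measurable.
- apply: lim_sup_set_cvg0 => //.
  have : (\sum_(n <oo) P (F n) <= (2 * C)%:E)%E.
    apply: lime_le; first exact: is_cvg_nneseries.
    apply: nearW => n.
    rewrite (@le_trans _ _ (\sum_(0 <= k < n) (C / k.+1%:R ^+ 2)%:E)%E)//.
      by apply: lee_sum => i _.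
    rewrite sumEFin lee_fin -mulr_sumr mulrC ler_wpM2r//.
    exact: sum_inv_sqr_le.
  by move/le_lt_trans; apply; exact: ltry.
- move=> w /= nF n _; apply: contrapT => H; apply: nF.
  exists n => // m /= nm Fm; apply: H; by exists m.
Qed.

(** Both applications give measurability and the bound for large n only, so
    the finitely many other events are replaced by the empty set, and indices
    are shifted to avoid the division by 0. *)
Lemma near_borel_cantelli_inv_sqr (C : R) (F : nat -> set T) :
  (\forall n \near \oo,
    measurable (F n) /\ (P (F n) <= (C / n%:R ^+ 2)%:E)%E) ->
  {ae P, forall w, \forall n \near \oo, ~ F n w}.
Proof.
case=> N _ FN.
pose G n := if (N <= n)%N then F n.+1 else set0.
have C0 : 0 <= C.
  have [_ /(le_trans (measure_ge0 P _))] := FN N.+1 (leqnSn N).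
  by rewrite lee_fin pmulr_lge0// invr_gt0 exprn_gt0.
have : {ae P, forall w, \forall n \near \oo, ~ G n w}.
  apply: (@borel_cantelli_inv_sqr C) => n; rewrite /G; case: ifPn => // Nn.
  - by have [] := FN _ (leqW Nn).
  - by have [] := FN _ (leqW Nn).
  - by rewrite measure0 lee_fin divr_ge0// exprn_ge0.
apply: filterS => w [M _ GM]; exists (N + M).+1 => // -[//|n] /= NMn.
have := GM n; rewrite /G (leq_trans (leq_addr M N))//; apply.
by rewrite /= (leq_trans (leq_addl N M)).
Qed.

End borel_cantelli.

(** * A strong law of large numbers *)

Lemma fourth_powers_gap (n : nat) : (0 < n)%N ->
  exists2 k, (0 < k)%N & (k ^ 4 <= n < k.+1 ^ 4)%N.
Proof.
move=> n0.
have ex : exists k, (k ^ 4 <= n)%N by exists 0%N.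
have ub k : (k ^ 4 <= n)%N -> (k <= n)%N.
  by apply: leq_trans; case: k => // k; rewrite -[leqLHS]expn1 leq_pexp2l.
have [k kn kmax] := ex_maxnP ex ub.
exists k; first by apply: kmax.
rewrite kn ltnNge; apply/negP => /kmax; by rewrite ltnn.
Qed.

(** For k^4 <= n < (k+1)^4 the sum of length n differs from the one of length
    k^4 by fewer than 15 k^3 terms, all bounded by C; dividing by n >= k^4, the
    mean is at most (1 + 15 C) / k. *)
Lemma cvg_mean_of_fourth_powers (R : realType) (x : nat -> R) (C : R) :
  (forall i, `|x i| <= C) ->
  (\forall k \near \oo, `|\sum_(i < k ^ 4) x i| < k%:R ^+ 3) ->
  n%:R^-1 * (\sum_(i < n) x i) @[n --> \oo] --> (0 : R).
Proof.
move=> xC [K _ xK].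
have C0 : 0 <= C := le_trans (normr_ge0 _) (xC 0%N).
apply/cvgr0Pnorm_le => e e0.
pose K' := maxn K (Num.truncn ((1 + 15 * C) / e)).+1.
exists (K'.+1 ^ 4)%N => // n /= K'n.
have n0 : (0 < n)%N by apply: leq_trans K'n; rewrite expn_gt0.
have [k k0 /andP[kn nk]] := fourth_powers_gap n0.
have K'k : (K' <= k)%N.
  have := leq_ltn_trans K'n nk.
  by rewrite ltn_exp2r// ltnS => /ltnW.
have kR : 0 < k%:R :> R by rewrite ltr0n.
have k1 : 1 <= k%:R :> R by rewrite ler1n.
have nR : 0 < n%:R :> R by rewrite ltr0n.
have small : (1 + 15 * C) <= e * k%:R.
  rewrite [e * _]mulrC -ler_pdivrMr//.
  apply: (@le_trans _ _ K'%:R); last by rewrite ler_nat.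
  apply: (@le_trans _ _ (Num.truncn ((1 + 15 * C) / e)).+1%:R).
    by rewrite ltW// truncnS_gt.
  by rewrite ler_nat leq_maxr.
have -> : \sum_(i < n) x i = \sum_(i < k ^ 4) x i + \sum_(k ^ 4 <= i < n) x i.
  by rewrite -!(big_mkord predT x) -big_cat_nat.
have tail : `|\sum_(k ^ 4 <= i < n) x i| <= C * (15 * k%:R ^+ 3).
  rewrite (le_trans (ler_norm_sum _ _ _))//.
  apply: (@le_trans _ _ (\sum_(k ^ 4 <= i < n) C)); first exact: ler_sum.
  rewrite sumr_const_nat -[leLHS]mulr_natr ler_wpM2l//.
  rewrite natrB//.
  have : n%:R <= k.+1%:R ^+ 4 :> R by rewrite -natrX ler_nat ltnW.
  rewrite natrX -natr1.
  set y : R := k%:R in kR k1 *.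
  have y2 : y <= y ^+ 3 by nra.
  have y3 : y ^+ 2 <= y ^+ 3 by nra.
  have y4 : 1 <= y ^+ 3 by nra.
  have -> : (y + 1) ^+ 4 = y ^+ 4 + 4 * y ^+ 3 + 6 * y ^+ 2 + 4 * y + 1 by ring.
  lra.
rewrite normrM normfV normr_nat [leLHS]mulrC ler_pdivrMr//.
rewrite (le_trans (ler_normD _ _))//.
rewrite (le_trans (lerD (ltW (xK k _)) tail))//=.
  by rewrite (leq_trans _ K'k)// leq_maxl.
apply: (@le_trans _ _ ((1 + 15 * C) * k%:R ^+ 3)); first lra.
apply: (@le_trans _ _ (e * k%:R * k%:R ^+ 3)).
  by rewrite ler_wpM2r// exprn_ge0.
rewrite -mulrA; apply: ler_wpM2l; first exact: ltW.
by rewrite -exprS -natrX ler_nat.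
Qed.

Section bounded_uncorrelated.
Context d (T : measurableType d) (R : realType) (P : probability T R).

Lemma bounded_Lfun2 (X : T -> R) (M : R) : measurable_fun setT X ->
  (forall w, `|X w| <= M) -> X \in Lfun P 2%:E.
Proof.
move=> mX XM.
rewrite inE; apply/andP; split; rewrite inE//= /finite_norm.
rewrite unlock /= poweR_lty//.
rewrite (@le_lt_trans _ _ (\int[P]_x (M `^ 2)%:E)%E)//; last first.
  by rewrite integral_cst//= probability_setT mule1 ltry.
apply: ge0_le_integral => //=.
- apply/measurable_EFinP.
  apply: (@measurableT_comp _ _ _ _ _ _ (@powR R ^~ 2)) => //.
  exact: measurableT_comp.
- move=> x _; rewrite lee_fin ge0_ler_powR// nnegrE.
  by rewrite (le_trans _ (XM x)).
Qed.

Lemma mfun_sumE (X : nat -> {RV P >-> R}) n w :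
  (\sum_(i < n) (X i : {mfun T >-> R})) w = \sum_(i < n) X i w.
Proof.
elim: n => [|n IH]; first by rewrite !big_ord0.
by rewrite !big_ord_recr/= -IH.
Qed.

Variables (X : nat -> {RV P >-> R}) (M m : R).
Hypothesis XM : forall i w, `|X i w| <= M.
Hypothesis EX : forall i, ('E_P[X i] = m%:E)%E.
Hypothesis covX : forall i j, i != j -> covariance P (X i) (X j) = 0%E.

Let S n : {RV P >-> R} := \sum_(i < n) (X i : {mfun T >-> R}).

Let SS n : S n.+1 = (S n \+ X n) :> (T -> R).
Proof. by rewrite /S big_ord_recr. Qed.

Let X2 i : (X i : T -> R) \in Lfun P 2%:E.
Proof. exact: bounded_Lfun2 (XM i). Qed.

Let S2 n : (S n : T -> R) \in Lfun P 2%:E.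
Proof.
elim: n => [|n IH]; last by rewrite SS rpredD ?lee1n.
rewrite /S big_ord0; apply: Lfun_cst.
Qed.

Let Lfun21 (Y : T -> R) : Y \in Lfun P 2%:E -> Y \in Lfun P 1.
Proof. by apply: Lfun_subset12; exact: fin_num_measure. Qed.

Let ES n : ('E_P[S n] = (n%:R * m)%:E)%E.
Proof.
elim: n => [|n IH]; last first.
  by rewrite SS expectationD ?Lfun21// IH EX -natr1 mulrDl mul1r EFinD.
by rewrite /S big_ord0 mul0r expectation_cst.
Qed.

Let covSX n j : (n <= j)%N -> covariance P (S n) (X j) = 0%E.
Proof.
elim: n => [|n IH] nj; first by rewrite /S big_ord0 covariance_cst_l.
by rewrite SS covarianceDl// IH ?(ltnW nj)// add0e covX// ltn_eqF.
Qed.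

Let VX i : ('V_P[X i] <= (M ^+ 2)%:E)%E.
Proof.
rewrite varianceE// EX -EFin_expe leeBlDr// (@le_trans _ _ (M ^+ 2)%:E)//; last first.
  by rewrite -EFinD lee_fin lerDl sqr_ge0.
have := @expectation_cst _ _ _ P (M ^+ 2) => <-.
apply: expectation_le => //=.
- by move=> x; exact: sqr_ge0.
- by move=> x; exact: sqr_ge0.
- apply: aeW => w /=.
  by rewrite -[leLHS]real_normK ?num_real// lerXn2r ?nnegrE// (le_trans _ (XM i w)).
Qed.

Let VS n : ('V_P[S n] <= (n%:R * M ^+ 2)%:E)%E.
Proof.
elim: n => [|n IH]; first by rewrite /S big_ord0 mul0r variance_cst.
rewrite SS varianceD// covSX// mule0 adde0 -natr1 mulrDl mul1r EFinD.
by rewrite leeD.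
Qed.

(* Fourth powers are the right subsequence: the variance is at most k^4 M^2, so
   the threshold k^3, although negligible with respect to the length k^4,
   leaves the summable bound M^2 / k^2. *)
Let PS k : (0 < k)%N ->
  (P [set w | (k%:R ^+ 3 <= `|S (k ^ 4) w - k%:R ^+ 4 * m|)%R]
  <= ((M ^+ 2) / k%:R ^+ 2)%:E)%E.
Proof.
move=> k0.
have kR : 0 < k%:R :> R by rewrite ltr0n.
have := @chebyshev _ _ _ P (S (k ^ 4)) (k%:R ^+ 3) (exprn_gt0 _ kR).
rewrite ES /= natrX => /le_trans; apply.
apply: (@le_trans _ _ (((k%:R ^+ 3) ^- 2)%:E * ((k ^ 4)%:R * M ^+ 2)%:E)%E).
  by rewrite lee_wpmul2l ?lee_fin ?invr_ge0 ?exprn_ge0 ?VS.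
rewrite -EFinM lee_fin natrX le_eqVlt; apply/orP; left; apply/eqP.
by field; rewrite gt_eqF.
Qed.

Lemma ae_fourth_power_partial_sums : {ae P, forall w, \forall k \near \oo,
  `|\sum_(i < k ^ 4) (X i w - m)| < k%:R ^+ 3}.
Proof.
have : {ae P, forall w, \forall k \near \oo,
    ~ [set w | (k%:R ^+ 3 <= `|S (k ^ 4) w - k%:R ^+ 4 * m|)%R] w}.
  apply: (@near_borel_cantelli_inv_sqr _ _ _ _ (M ^+ 2)).
  exists 1%N => // k /= k1; split; last exact: PS.
  rewrite -[X in measurable X]setTI.
  apply: measurable_fun_le => //; apply: measurableT_comp => //.
  exact: measurable_funB.
apply: filterS => w [N _ SN]; exists N => // k Nk /=.
have /= /negP := SN k Nk; rewrite -ltNge.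
rewrite /S mfun_sumE.
by rewrite sumrB sumr_const card_ord -[m *+ _]mulr_natl natrX.
Qed.

(** Vanishing covariances make the variance of the partial sums grow linearly,
    which gives almost sure convergence along the fourth powers; boundedness
    extends it to all n. *)
Lemma slln_bounded_uncorrelated :
  {ae P, forall w, n%:R^-1 * (\sum_(i < n) X i w) @[n --> \oo] --> m}.
Proof.
apply: filterS ae_fourth_power_partial_sums => w Sw.
have /(cvgD (cvg_cst m)) : n%:R^-1 * (\sum_(i < n) (X i w - m)) @[n --> \oo] --> 0.
  apply: (@cvg_mean_of_fourth_powers _ (fun i => X i w - m) (M + `|m|)) => // i.
  by rewrite (le_trans (ler_normB _ _))// lerD2r.
rewrite addr0; apply: cvg_trans; apply: near_eq_cvg.
exists 1%N => // n /= n0.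
have nR : n%:R != 0 :> R by rewrite pnatr_eq0 -lt0n.
rewrite -[LHS]/(m + n%:R^-1 * \sum_(i < n) (X i w - m)).
by rewrite sumrB sumr_const card_ord -[m *+ _]mulr_natl mulrBr mulKf// addrC subrK.
Qed.

End bounded_uncorrelated.

Section independence_expectation.
Context d (T : measurableType d) (R : realType) (P : probability T R).

Lemma bounded_integrable d' (T' : measurableType d') (Q : probability T' R)
    (h : T' -> R) (C : R) :
  measurable_fun setT h -> (forall x, `|h x| <= C) ->
  Q.-integrable setT (EFin \o h).
Proof.
move=> mh hC; apply: measurable_bounded_integrable => //.
  by rewrite /= probability_setT ltry.
exists C; split; first exact: num_real.
by move=> M CM x _; exact: le_trans (hC x) (ltW CM).
Qed.

(** The product rule on rectangles says that the law of (X, Y) is the product of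
    the laws of X and Y; Fubini's theorem then factors the expectation. *)
Lemma expectation_mul_independent (X Y : {RV P >-> R}) (g h : R -> R) (C D : R) :
  (forall A B, measurable A -> measurable B ->
    P (X @^-1` A `&` Y @^-1` B) = (P (X @^-1` A) * P (Y @^-1` B))%E) ->
  measurable_fun setT g -> measurable_fun setT h ->
  (forall x, `|g x| <= C) -> (forall x, `|h x| <= D) ->
  ('E_P[(g \o X) \* (h \o Y)] = 'E_P[g \o X] * 'E_P[h \o Y])%E.
Proof.
move=> XY mg mh gC hD.
pose XYm : {mfun T >-> (R * R)%type} := mfun_Sub (mem_set (measurable_fun_pair
   (measurable_funP X) (measurable_funP Y))).
have mgh : measurable_fun setT (fun z : R * R => g z.1 * h z.2).
  apply: measurable_funM; exact: measurableT_comp.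
have ghCD (z : R * R) : `|g z.1 * h z.2| <= C * D.
  by rewrite normrM ler_pM.
have E (x : R) : (\int[distribution P Y]_y (g x * h y)%:E =
    (g x)%:E * \int[distribution P Y]_y (h y)%:E)%E.
  rewrite (@integralZl _ _ _ _ _ _ (EFin \o h))//.
  exact: bounded_integrable hD.
rewrite unlock.
transitivity (\int[distribution P XYm]_z (g z.1 * h z.2)%:E)%E.
  rewrite integral_distribution//.
    exact/measurable_EFinP.
  apply: (@bounded_integrable _ _ _ (fun w => g (X w) * h (Y w)) (C * D)).
    by apply: measurable_funM; exact: measurableT_comp.
  by move=> w; exact: (ghCD (X w, Y w)).
transitivity (\int[distribution P X \x distribution P Y]_z (g z.1 * h z.2)%:E)%E.
  apply: eq_measure_integral => A mA _.
  apply/esym; exact: product_measure_unique.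
transitivity (\int[distribution P X]_x \int[distribution P Y]_y (g x * h y)%:E)%E.
  rewrite -integral12_prod_meas1//.
  exact: (@bounded_integrable _ _ _ _ (C * D)).
under eq_integral do rewrite E.
have IY : (distribution P Y).-integrable setT (EFin \o h).
  exact: bounded_integrable hD.
rewrite -(fineK (integrable_fin_num measurableT IY)) integralZr//; last first.
  exact: bounded_integrable gC.
rewrite fineK ?integrable_fin_num//.
congr (_ * _)%E; rewrite integral_distribution//; try exact/measurable_EFinP.
- apply: (@bounded_integrable _ _ _ _ C) => //; exact: measurableT_comp.
- apply: (@bounded_integrable _ _ _ _ D) => //; exact: measurableT_comp.
Qed.

End independence_expectation.

Section independent_sample.
Context d (Omega : measurableType d) (R : realType) (P : probability Omega R).
Variables (mu : probability R R) (theta : nat -> {RV P >-> R}).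

Lemma ae_mean_cvg_of_independent (g : R -> R) (M : R) :
  mutually_independent theta -> (forall j, has_law (theta j) mu) ->
  measurable_fun setT g -> (forall x, `|g x| <= M) ->
  {ae P, forall w, n%:R^-1 * (\sum_(i < n) g (theta i w)) @[n --> \oo] -->
    \int[mu]_y g y}.
Proof.
move=> indep law mg gM.
have mX i : measurable_fun setT (g \o theta i) by exact: measurableT_comp.
pose X i : {RV P >-> R} := mfun_Sub (mem_set (mX i)).
have XM i w : `|X i w| <= M by exact: gM.
have EX i : ('E_P[X i] = (\int[mu]_y g y)%:E)%E.
  rewrite expectation_def -(@integral_distribution _ _ _ _ _ P (theta i) (EFin \o g)).
  - rewrite fineK; last first.
      by apply: integrable_fin_num => //; exact: bounded_integrable gM.
    by apply: eq_measure_integral => A mA _; exact: law.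
  - exact/measurable_EFinP.
  - have := @bounded_integrable _ _ _ P (g \o theta i) M (mX i) (XM i); exact.
have covX i j : i != j -> covariance P (X i) (X j) = 0%E.
  move=> ij.
  have X2 k : (X k : Omega -> R) \in Lfun P 2%:E := bounded_Lfun2 P (mX k) (XM k).
  have X1 k : (X k : Omega -> R) \in Lfun P 1.
    exact: (Lfun_subset12 (fin_num_measure P _ measurableT) (X2 k)).
  rewrite covarianceE ?(Lfun2_mul_Lfun1 (X2 i) (X2 j))//.
  have -> : ('E_P[(X i * X j)%R] = 'E_P[X i] * 'E_P[X j])%E.
    (* The product rule for theta i and theta j is the case of the subfamily
       [:: i; j]. *)
    apply: (expectation_mul_independent _ mg mg gM gM) => A B mA mB.
    pose AB k := if k == i then A else B.
    have := @indep [:: i; j] AB.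
    rewrite /= inE ij /= !big_cons !big_nil setIT mule1 /AB eqxx.
    rewrite eq_sym in ij; rewrite (negbTE ij); apply => // k.
    by case: ifP.
  by rewrite !EX subee.
exact: slln_bounded_uncorrelated XM EX covX.
Qed.
End independent_sample.

(** * Support of a probability and discrete measures *)

(** Every point outside the support lies in a null open set, hence in a null
    interval with rational endpoints, and there are countably many of those. *)
Lemma measure_support_negligible (R : realType) (mu : probability R R) :
  mu.-negligible (~` measure_support mu).
Proof.
pose I (pq : rat * rat) : set R := `]ratr pq.1, ratr pq.2[%classic.
pose G n := if unpickle n is Some pq then
  if mu (I pq) == 0%E then I pq else set0 else set0.
suff : ~` measure_support mu `<=` \bigcup_n G n.
  move/negligibleS; apply.
  apply: negligible_bigcup => n; rewrite /G.
  case: unpickle => [pq|]; last exact: negligible_set0.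
  case: eqP => [I0|_]; last exact: negligible_set0.
  by exists (I pq); split => //; exact: measurable_itv.
move=> x /existsNP[U /not_implyP[oU /not_implyP[Ux /negP]]].
rewrite -leNgt => U0.
have [e /= e0 eU] := (nbhs_ballP _ _).1 (open_nbhs_nbhs (conj oU Ux)).
have [p px] := @rat_in_itvoo R (x - e) x ltac:(lra).
have [q qx] := @rat_in_itvoo R x (x + e) ltac:(lra).
rewrite !in_itv/= in px qx.
have IU : I (p, q) `<=` U.
  move=> y; rewrite /I /= in_itv/= => ypq; apply: eU.
  by rewrite /ball/= ltr_norml; lra.
have Gx : G (pickle (p, q)) = I (p, q).
  rewrite /G pickleK ifT//.
  rewrite eq_le measure_ge0 andbT (le_trans _ U0)//.
  by apply: le_measure => //; rewrite inE; [exact: measurable_itv|exact: open_measurable].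
(* The witness is passed as a term: a closing tactic would try to evaluate the
   code of (p, q). *)
apply: (ex_intro2 _ _ (pickle (p, q)) Logic.I).
by rewrite Gx /I /= in_itv/=; lra.
Qed.

Lemma integral_scaled_dirac_sum (R : realType) d (T : measurableType d)
    (k : {nonneg R}) (a : nat -> T) (n : nat) (g : T -> R) :
  measurable_fun setT g ->
  \int[mscale k (msum (fun i => \d_(a i)) n)]_x g x =
  k%:num * \sum_(i < n) g (a i).
Proof.
move=> mg.
have H (h : T -> \bar R) : measurable_fun setT h -> (forall x, (0 <= h x)%E) ->
    (\int[mscale k (msum (fun i => \d_(a i)) n)]_x h x =
     k%:num%:E * \sum_(i < n) h (a i))%E.
  move=> mh h0; rewrite ge0_integral_mscale//; congr (_ * _)%E.
  rewrite ge0_integral_measure_sum//; apply: eq_bigr => i _.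
  by rewrite integral_dirac//= diracT mul1e.
rewrite /Rintegral integralE funerpos funerneg !H//; first last.
- by move=> x; rewrite lee_fin funrpos_ge0.
- exact/measurable_EFinP/measurable_funrpos.
- by move=> x; rewrite lee_fin funrneg_ge0.
- exact/measurable_EFinP/measurable_funrneg.
rewrite /= !sumEFin -!EFinM /= -mulrBr -sumrB; congr (_ * _).
by apply: eq_bigr => i _; rewrite -[in RHS](funrposBneg g).
Qed.

(** * Test functions *)

Lemma bounded_outside_compact (R : realType) (h : R -> R) (K : set R) :
  compact K -> continuous h -> (forall x, ~ K x -> h x = 0) ->
  exists2 M, 0 <= M & forall x, `|h x| <= M.
Proof.
move=> cK ch h0.
have /compact_bounded [M [_ hM]] : compact (h @` K).
  apply: continuous_compact => //; exact: continuous_subspaceT.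
exists (`|M| + 1) => [|x]; first by rewrite addr_ge0.
have [Kx|Kx] := pselect (K x); last by rewrite h0// normr0 addr_ge0.
by apply: (hM (`|M| + 1)); [rewrite ltr_pwDr// ler_norm|exists x].
Qed.

Section C1.
Context (R : realType) (g : R -> R).
Hypothesis gC1 : C1_compact_support g.

Lemma C1_compact_support_continuous : continuous g.
Proof.
have [dg _ _] := gC1.
by move=> x; apply/differentiable_continuous/derivable1_diffP.
Qed.

Lemma C1_compact_support_bounded : exists2 M, 0 <= M & forall x, `|g x| <= M.
Proof.
have [dg _ cK] := gC1.
apply: (bounded_outside_compact cK C1_compact_support_continuous) => x Kx.
apply/eqP/negPn/negP => gx; apply: Kx; exact: subset_closure.
Qed.

Lemma C1_compact_support_lipschitz :
  exists2 L, 0 <= L & forall x y, `|g x - g y| <= L * `|x - y|.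
Proof.
have [dg cdg cK] := gC1.
have [x Kx|L L0 dgL] := bounded_outside_compact cK cdg.
  rewrite derive1E (@near_eq_derive _ _ _ _ (cst 0)) ?derive_cst//.
  have : nbhs x (~` closure [set x | g x != 0]).
    by apply: open_nbhs_nbhs; split => //; apply: closed_openC; exact: closed_closure.
  apply: filterS => y /= Ky; apply/eqP/negPn/negP => gy; apply: Ky.
  exact: subset_closure.
exists L => //.
have H x y : x <= y -> `|g y - g x| <= L * `|y - x|.
  move=> xy.
  have [||c _ ->] := @MVT_segment R g (derive1 g) x y xy.
  - by move=> z _; rewrite derive1E; exact/derivableP.
  - by apply: continuous_subspaceT => z; exact: C1_compact_support_continuous.
  by rewrite normrM ler_wpM2r.
move=> x y; have [xy|/ltW xy] := leP x y; last exact: H.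
by rewrite distrC [X in L * X]distrC H.
Qed.
End C1.

(** * Uniform deviation bound for the estimators *)

Section deviation.
Context d (Omega : measurableType d) (R : realType) (P : probability Omega R).

(** As q has no lower bound, its integral is first bounded by that of its
    positive part, on which the almost sure bound c >= 0 remains valid. *)
Lemma cond_prob_given_le (E : set Omega) (X : {RV P >-> R}) (q : R -> R) (c : R) :
  cond_prob_given E X q -> 0 <= c ->
  {ae distribution P X, forall x, q x <= c} -> (P E <= c%:E)%E.
Proof.
move=> [mq /(_ _ measurableT)]; rewrite preimage_setT setIT => -> c0 qc.
rewrite integralE.
apply: (@le_trans _ _ (\int[distribution P X]_x (EFin \o q)^\+%E x)%E).
  by rewrite geeDl// leeNl oppe0 integral_ge0.
rewrite -[leRHS]mule1 -(@probability_setT _ _ _ (distribution P X)) -integral_cst//.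
apply: ae_ge0_le_integral => //.
- exact/measurable_funepos/measurable_EFinP.
- apply: filterS qc => x qx _; rewrite funerpos lee_fin /= ge_max qx.
  exact: c0.
Qed.

Variables (theta : nat -> {RV P >-> R}) (eps : nat -> nat -> nat -> {RV P >-> R})
  (sigma : R) (est : forall n : nat, nat -> n.-tuple R -> R).

Lemma observation_measurable (h : R -> R) n j i : measurable_fun setT h ->
  measurable_fun setT (observation theta eps sigma h n j i).
Proof.
move=> mh; apply: measurable_funD; last exact: measurable_funM.
by apply: measurableT_comp => //; exact: measurable_funB.
Qed.

Lemma theta_hat_measurable (h : R -> R) n j : measurable_fun setT h ->
  preimage_set_system setT (theta_hat theta eps sigma est h n j) measurable `<=`
    g_sigma_preimage (fun i : 'I_n => observation theta eps sigma h n j i) ->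
  measurable_fun setT (theta_hat theta eps sigma est h n j).
Proof.
move=> mh sub _ A mA.
have /sub : preimage_set_system setT (theta_hat theta eps sigma est h n j)
   measurable (setT `&` theta_hat theta eps sigma est h n j @^-1` A) by exists A.
apply: smallest_sub.
  exact: sigma_algebra_measurable.
apply: (big_ind (fun S => S `<=` measurable)) => //.
  by move=> S1 S2 mS1 mS2 C [/mS1|/mS2].
by move=> i _ _ [C mC <-]; exact: observation_measurable.
Qed.

End deviation.

(** The deviation bound at x_n = K sqrt (ln n) is a power of n; the choice
    K = sqrt (a / c) makes its exponent equal to -a. *)
Lemma expR_sqr_sqrt_ln (R : realType) (c a : R) (n : nat) :
  (0 < n)%N -> 0 < c -> 0 <= a ->
  expR (- c * (Num.sqrt (a / c) * Num.sqrt (ln n%:R)) ^+ 2) = n%:R `^ (- a).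
Proof.
move=> n0 c0 a0.
have ac0 : 0 <= a / c by rewrite divr_ge0// ltW.
rewrite exprMn !sqr_sqrtr ?ln_ge0 ?ler1n//.
rewrite /powR pnatr_eq0 eqn0Ngt n0/=; congr expR.
by field; rewrite gt_eqF.
Qed.

(** ln n = 2 ln (sqrt n) <= 2 sqrt n, and 2 sqrt n <= e^2 n for large n. *)
Lemma near_sqrt_ln_le (R : realType) (e : R) : 0 < e ->
  \forall n \near \oo, Num.sqrt (ln n%:R) <= e * Num.sqrt n%:R.
Proof.
move=> e0; exists (Num.truncn ((2 / e ^+ 2) ^+ 2)).+1 => // n /= nN.
have n0 : (0 < n)%N by exact: leq_trans nN.
have nR : 0 < n%:R :> R by rewrite ltr0n.
set s := Num.sqrt n%:R.
have s0 : 0 < s by rewrite sqrtr_gt0.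
have s2 : n%:R = s ^+ 2 by rewrite sqr_sqrtr.
have e2 : 0 < e ^+ 2 by rewrite exprn_gt0.
have es : 2 <= e ^+ 2 * s.
  rewrite mulrC -ler_pdivrMr// -(@ler_pXn2r _ 2)// ?nnegrE ?divr_ge0 1?ltW// -s2.
  by rewrite (lt_le_trans (truncnS_gt _))// ler_nat.
have es0 : 0 <= e * s by rewrite mulr_ge0 ?ltW.
rewrite -[e * s]ger0_norm// -sqrtr_sqr; apply: ler_wsqrtr.
rewrite exprMn s2 [in ln _]expr2 lnM ?posrE//.
have := ln_sublinear s0.
nra.
Qed.

Section uniform_deviation.
Context d (Omega : measurableType d) (R : realType) (P : probability Omega R).
Variables (mu : probability R R) (theta : nat -> {RV P >-> R})
  (eps : nat -> nat -> nat -> {RV P >-> R}) (sigma : R)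
  (F : set (R -> R)) (f : nat -> R -> R) (J : nat -> nat) (alpha B : R)
  (est : forall n : nat, nat -> n.-tuple R -> R).
Hypothesis F_measurable : forall h, F h -> measurable_fun setT h.
Hypothesis f_in_F : forall j, F (f j).
Hypothesis law : forall j, has_law (theta j) mu.
Hypothesis approx :
  approximates theta eps sigma est (measure_support mu) F J.
Hypothesis alpha_gt0 : 0 < alpha.
Hypothesis J_le : forall n, (1 <= n)%N -> (J n)%:R <= B * n%:R `^ alpha.

Let err n j w := Num.sqrt n%:R *
  `|theta_hat theta eps sigma est (f j) n j w - theta j w|.

(** The constant K is chosen so that J_n times the deviation probability is of
    order n^-2; polynomial growth of J_n is what makes this possible. *)
Lemma ae_uniform_deviation : exists K : R, {ae P, forall w,
  \forall n \near \oo, forall j, (j < J n)%N ->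
    err n j w <= K * Num.sqrt (ln n%:R)}.
Proof.
have [meas [c1 [c2 [c10 c20 dev]]]] := approx.
have a2 : 0 < alpha + 2 by rewrite addr_gt0.
pose K := Num.sqrt ((alpha + 2) / c2).
have K0 : 0 < K by rewrite sqrtr_gt0 divr_gt0.
exists K.
pose E n j := [set w | err n j w > K * Num.sqrt (ln n%:R)].
have mE n j : (j < J n)%N -> measurable (E n j).
  move=> jJ; have -> : E n j = ~` [set w | err n j w <= K * Num.sqrt (ln n%:R)].
    apply/seteqP; split=> w /=; first by rewrite /E /= ltNge => /negP.
    by move/negP; rewrite -ltNge.
  apply: measurableC; rewrite -[X in measurable X]setTI.
  apply: measurable_fun_le => //.
  apply: measurable_funM => //; apply: measurableT_comp => //.
  apply: measurable_funB => //; apply: theta_hat_measurable.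
    exact: F_measurable.
  exact: meas.
have PE : \forall n \near \oo, forall j, (j < J n)%N ->
    (P (E n j) <= (c1 * n%:R `^ (- (alpha + 2)))%:E)%E.
  have [N _ HN] := dev K K0.
  exists N.+1 => // n /= Nn j jJ.
  have [q [Eq qle]] := HN n (ltnW Nn) j (f j) jJ (f_in_F j).
  have n0 : (0 < n)%N by exact: leq_trans Nn.
  apply: (cond_prob_given_le Eq).
    by rewrite mulr_ge0 ?powR_ge0// ltW.
  have [A [mA A0 suppA]] := measure_support_negligible mu.
  exists A; split => //; first by rewrite law.
  move=> x /= qx; apply: suppA => sx; apply: qx.
  by rewrite -(expR_sqr_sqrt_ln n0 c20 (ltW a2)) qle.
have : {ae P, forall w, \forall n \near \oo, ~ (\bigcup_(j < J n) E n j) w}.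
  apply: (@near_borel_cantelli_inv_sqr _ _ _ _ (B * c1)).
  near=> n.
  have n0 : (0 < n)%N by near: n; exists 1%N.
  have PEn : forall j, (j < J n)%N ->
    (P (E n j) <= (c1 * n%:R `^ (- (alpha + 2)))%:E)%E by near: n.
  rewrite bigcup_mkord; split.
    by apply: bigsetU_measurable => j _; exact: mE.
  rewrite (le_trans (Boole_inequality _ _))//; first by move=> j; exact: mE.
  rewrite (@le_trans _ _ (\sum_(j < J n) (c1 * n%:R `^ (- (alpha + 2)))%:E)%E)//.
    by apply: lee_sum => j _; exact: PEn.
  rewrite sumEFin lee_fin sumr_const card_ord -[leLHS]mulr_natl.
  apply: (@le_trans _ _ (B * n%:R `^ alpha * (c1 * n%:R `^ (- (alpha + 2))))).
    by rewrite ler_wpM2r ?J_le// mulr_ge0 ?powR_ge0// ltW.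
  rewrite mulrACA -powRD; last by rewrite pnatr_eq0 -lt0n n0 implybT.
  by rewrite opprD addrA subrr add0r powR_invn.
apply: filterS => w [N _ HN]; exists N => // n /HN H j jJ.
by rewrite leNgt; apply/negP => Ej; apply: H; exists j.
Unshelve. all: by end_near.
Qed.

End uniform_deviation.

(** * Convergence of the empirical means *)

Lemma cvg_mean_of_near_sample (R : realType) (g : R -> R) (L K m : R)
    (J : nat -> nat) (a : nat -> nat -> R) (t : nat -> R) :
  0 <= L -> (forall x y, `|g x - g y| <= L * `|x - y|) ->
  J n @[n --> \oo] --> \oo ->
  (\forall n \near \oo, forall j, (j < J n)%N ->
     Num.sqrt n%:R * `|a n j - t j| <= K * Num.sqrt (ln n%:R)) ->
  n%:R^-1 * (\sum_(j < n) g (t j)) @[n --> \oo] --> m ->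
  (J n)%:R^-1 * (\sum_(j < J n) g (a n j)) @[n --> \oo] --> m.
Proof.
move=> L0 gL Joo near_at tm.
have {}tm : (J n)%:R^-1 * (\sum_(j < J n) g (t j)) @[n --> \oo] --> m.
  exact: cvg_comp Joo tm.
have diff : (J n)%:R^-1 * (\sum_(j < J n) g (a n j)) -
    (J n)%:R^-1 * (\sum_(j < J n) g (t j)) @[n --> \oo] --> 0.
  apply/cvgr0Pnorm_le => e e0.
  have K1 : 0 < `|K| + 1 by rewrite ltr_pwDr.
  have L1 : 0 < L + 1 by rewrite ltr_pwDr.
  pose e' := e / ((L + 1) * (`|K| + 1)).
  have e'0 : 0 < e' by rewrite divr_gt0// mulr_gt0.
  have Jpos : \forall n \near \oo, (0 < J n)%N.
    by apply: (Joo [set k | (0 < k)%N]); exists 1%N.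
  near=> n.
  have n0 : 0 < Num.sqrt n%:R :> R.
    by rewrite sqrtr_gt0 ltr0n; near: n; exists 1%N.
  have J0 : (0 < J n)%N by near: n; exact: Jpos.
  have lnn : Num.sqrt (ln n%:R) <= e' * Num.sqrt n%:R.
    by near: n; exact: near_sqrt_ln_le.
  have atn : forall j, (j < J n)%N ->
     Num.sqrt n%:R * `|a n j - t j| <= K * Num.sqrt (ln n%:R).
    by near: n.
  rewrite -mulrBr -sumrB normrM normfV normr_nat mulrC ler_pdivrMr ?ltr0n//.
  rewrite (le_trans (ler_norm_sum _ _ _))//.
  apply: (@le_trans _ _ (\sum_(j < J n) e)); last first.
    by rewrite sumr_const card_ord -[e *+ _]mulr_natr.
  apply: ler_sum => j _; rewrite (le_trans (gL _ _))//.
  have : Num.sqrt n%:R * `|a n j - t j| <= (`|K| + 1) * e' * Num.sqrt n%:R.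
    rewrite (le_trans (atn j (ltn_ord j)))// -mulrA.
    apply: (@le_trans _ _ ((`|K| + 1) * Num.sqrt (ln n%:R))).
      by rewrite ler_wpM2r// (le_trans (ler_norm _))// lerDl.
    by rewrite ler_wpM2l// ltW.
  rewrite mulrC ler_pM2r// => aj.
  apply: (@le_trans _ _ ((L + 1) * ((`|K| + 1) * e'))).
    by apply: ler_pM => //; rewrite lerDl.
  rewrite /e' le_eqVlt; apply/orP; left; apply/eqP; field.
  by rewrite !gt_eqF.
rewrite -[m]add0r (_ : (fun n => (J n)%:R^-1 * _) = fun n =>
    (J n)%:R^-1 * (\sum_(j < J n) g (a n j)) -
    (J n)%:R^-1 * (\sum_(j < J n) g (t j)) +
    (J n)%:R^-1 * (\sum_(j < J n) g (t j))); last first.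
  by apply/funext => n; rewrite subrK.
exact: cvgD diff tm.
Unshelve. all: by end_near.
Qed.

Theorem theorem3p2 (R : realType) (d : measure_display)
    (Omega : measurableType d) (P : probability Omega R)
    (mu : probability R R) (Theta : set R)
    (theta : nat -> {RV P >-> R})
    (eps : nat -> nat -> nat -> {RV P >-> R}) (sigma : R)
    (F : set (R -> R)) (f : nat -> R -> R)
    (J : nat -> nat) (alpha B : R)
    (est : forall n : nat, nat -> n.-tuple R -> R)
    (sigma_gt0 : 0 < sigma)
    (F_measurable : forall h, F h -> measurable_fun setT h)
    (f_in_F : forall j, F (f j))
    (J_ge1 : forall n, (1 <= n)%N -> (1 <= J n)%N)
    (model : shifted_curves_model theta eps mu J)
    (ThetaE : Theta = measure_support mu)
    (Theta_compact : compact Theta)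
    (approx : approximates theta eps sigma est Theta F J)
    (alpha_gt0 : 0 < alpha) (B_gt0 : 0 < B)
    (J_le : forall n, (1 <= n)%N -> (J n)%:R <= B * n%:R `^ alpha)
    (J_cvg : J n @[n --> \oo] --> \oo) :
  forall g : R -> R, C1_compact_support g ->
    {ae P, forall w,
      (\int[empirical_measure theta eps sigma est f J n w]_y g y)
        @[n --> \oo] --> \int[mu]_y g y}.
Proof.
move=> g gC1.
have [indep law _ _ _] := model.
have cg := C1_compact_support_continuous gC1.
have mg : measurable_fun setT g by exact: continuous_measurable_fun.
have [M _ gM] := C1_compact_support_bounded gC1.
have [L L0 gL] := C1_compact_support_lipschitz gC1.
rewrite ThetaE in approx.
have [K devK] := ae_uniform_deviation F_measurable f_in_F law approx alpha_gt0 J_le.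
have slln := ae_mean_cvg_of_independent indep law mg gM.
apply: filterS2 devK slln => w dev_w slln_w.
have -> : (fun n => \int[empirical_measure theta eps sigma est f J n w]_y g y) =
  fun n => (J n)%:R^-1 * (\sum_(j < J n) g (theta_hat theta eps sigma est (f j) n j w)).
  apply/funext => n; exact: (integral_scaled_dirac_sum _ _ _ mg).
exact: (cvg_mean_of_near_sample L0 gL J_cvg dev_w slln_w).
Qed.
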